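(* Let $(\Omega,\mathcal{F})$ be a measurable space, let $\mathcal{P}$ be the set of all probability measures on $(\Omega,\mathcal{F})$, let $H$ be an affine set of signed measures on $(\Omega,\mathcal{F})$ with finite total variation, and suppose that $\mathcal{M}:=\mathcal{P}\cap H$ is nonempty. For an element $p\in\mathcal{M}$, the following statements are equivalent. (i) $p$ is an extreme point of $\mathcal{M}$. (ii) There exists no $p'\in\mathcal{M}\setminus\{p\}$ with $p'\ll p$ and $p$-a.s. bounded density $\frac{\mathrm{d}p'}{\mathrm{d}p}$. (iii) For all $q\in\mathcal{M}$ with $p\ll q$ and all $\varepsilon\in(0,1)$, there exists no $p'\in\mathcal{M}\setminus\{p\}$ with $p'\ll q$, $q$-a.s. bounded density $\frac{\mathrm{d}p'}{\mathrm{d}q}$, and $$(1+\varepsilon)\frac{\mathrm{d}p}{\mathrm{d}q}-\varepsilon\frac{\mathrm{d}p'}{\mathrm{d}q}\geq 0\quad q\text{-a.s.}$$ (iv) For every $p'\in\mathcal{M}\setminus\{p\}$, every $p'$-admissible dominating measure $q$ of $p$, every $\varepsilon_0\in(0,1]$ satisfying $$q\Big(\Big\{\tfrac{\mathrm{d}p'}{\mathrm{d}q}\leq\tfrac{\mathrm{d}p}{\mathrm{d}q}<\varepsilon_0\Big\}\Big)=0,$$ and every continuous convex function $\varphi\colon[0,\infty)\to[0,\infty)$ with $\varphi(0)>0$ and $\varphi=0$ on $[a,\infty)$ for some $a\in(0,\varepsilon_0)$, the point $\lambda=1$ is a strict local maximizer of the map $$[0,1]\to[0,\infty),\quad \lambda\mapsto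 D_\varphi\big(\lambda p+(1-\lambda)p'\,\big\|\,q\big).$$
   Context: An affine set $H$ is a subset of the vector space of signed measures of finite total variation that contains $\lambda\mu+(1-\lambda)\nu$ for all $\mu,\nu\in H$ and $\lambda\in\mathbb{R}$. An extreme point of a convex set $\mathcal{C}$ of probability measures is a $p\in\mathcal{C}$ such that $p=\lambda p'+(1-\lambda)p''$ with $p',p''\in\mathcal{C}$ and $\lambda\in(0,1)$ implies $p'=p''=p$. We write $p\ll q$ for absolute continuity and $\frac{\mathrm{d}p}{\mathrm{d}q}\colon\Omega\to[0,\infty)$ for the Radon-Nikodym density. For a convex function $\varphi\colon[0,\infty)\to\mathbb{R}$ with $\varphi(1)=0$ and $p,q\in\mathcal{P}$ with $p\ll q$, the $\varphi$-divergence of $p$ with respect to $q$ is $$D_\varphi(p\,\|\,q):=\int_\Omega\varphi\Big(\frac{\mathrm{d}p}{\mathrm{d}q}\Big)\,\mathrm{d}q.$$ For $p,p'\in\mathcal{M}$ with $p\neq p'$, a measure $q$ is called a $p'$-admissible dominating measure of $p$ if $q\in\mathcal{M}$, $p\ll q$, and the following two conditions are satisfied: (a) $p'\ll q$ and $\frac{\mathrm{d}p'}{\mathrm{d}q}$ is $q$-a.s. bounded; (b) there exists $\varepsilon_0\in(0,1]$ such that $\frac{\mathrm{d}p'}{\mathrm{d}q}>\frac{\mathrm{d}p}{\mathrm{d}q}$ $q$-a.s. on $\{\frac{\mathrm{d}p}{\mathrm{d}q}<\varepsilon_0\}$, i.e. $q\big(\{\frac{\mathrm{d}p'}{\mathrm{d}q}\leq\frac{\mathrm{d}p}{\mathrm{d}q}<\varepsilon_0\}\big)=0$.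 The point $\lambda=1$ is a strict local maximizer of $f\colon[0,1]\to\mathbb{R}$ if there is $\delta>0$ with $f(\lambda)<f(1)$ for all $\lambda\in[0,1]\cap(1-\delta,1)$. *)

(* Defs.v *)
From HB Require Import structures.
From mathcomp Require Import all_boot all_order all_algebra.
From mathcomp Require Import interval_inference.
From mathcomp Require Import all_classical all_reals all_analysis.

Set Implicit Arguments.
Unset Strict Implicit.
Unset Printing Implicit Defensive.

Import Order.TTheory GRing.Theory Num.Theory.
Import numFieldNormedType.Exports.

Local Open Scope classical_set_scope.
Local Open Scope ring_scope.

(* In the library, measures and charges are functions on all subsets of T and
   are unconstrained outside the sigma-algebra.  Equality of (signed) measures
   on (T, F) is therefore equality on the measurable sets. *)
Definition eq_on_measurable d (T : measurableType d) (R : realType)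
    (mu nu : set T -> \bar R) : Prop :=
  forall A, measurable A -> mu A = nu A.

Section signed_measures.
Context d (T : measurableType d) (R : realType).

(* A [charge] is finite on every measurable set, that is, a signed measure of
   finite total variation.  The first clause says that H is a set of signed
   measures on the sigma-algebra: it does not depend on the values taken by a
   charge outside of it. *)
Definition affine_set (H : set ({charge set T -> \bar R})) : Prop :=
  (forall mu nu : {charge set T -> \bar R},
     eq_on_measurable mu nu -> H mu -> H nu) /\
  (forall (mu nu : {charge set T -> \bar R}) (l : R), H mu -> H nu ->
     H (cadd (cscale l mu) (cscale (1 - l) nu))).

Definition probabilities_in (H : set ({charge set T -> \bar R})) :
    set (probability T R) :=
  [set p | H (charge_of_finite_measure p)].

End signed_measures.

Section mixture.
Context d (T : measurableType d) (R : realType).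
Variables (l : {i01 R}) (p p' : probability T R).

Let l0 : 0 <= l%:num. Proof. by []. Qed.
Let l1 : 0 <= 1 - l%:num. Proof. by rewrite subr_ge0. Qed.

Definition mixture : set T -> \bar R :=
  measure_add (mscale (NngNum l0) p) (mscale (NngNum l1) p').

HB.instance Definition _ := Measure.on mixture.

Lemma mixtureE A :
  mixture A = (l%:num%:E * p A + (1 - l%:num)%:E * p' A)%E.
Proof. by rewrite /mixture measure_addE. Qed.

Let mixture_setT : mixture setT = 1%E.
Proof. by rewrite mixtureE !probability_setT !mule1 -EFinD addrC subrK. Qed.

HB.instance Definition _ :=
  Measure_isProbability.Build _ _ _ mixture mixture_setT.

End mixture.

Section extreme_point.
Context d (T : measurableType d) (R : realType).

Definition extreme_point (C : set (probability T R)) (p : probability T R) :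
    Prop :=
  C p /\
  forall (p' p'' : probability T R) (l : {i01 R}), C p' -> C p'' ->
    0 < l%:num < 1 -> eq_on_measurable p (mixture l p' p'') ->
    eq_on_measurable p' p /\ eq_on_measurable p'' p.

End extreme_point.

Section divergence.
Context d (T : measurableType d) (R : realType).
Implicit Types p q : probability T R.

(* [Radon_Nikodym_SigmaFinite.f p q] is, when p `<< q, a version of the
   Radon-Nikodym derivative of the (nonnegative) measure p that is finite and
   nonnegative everywhere; it is q-a.e. equal to
   ['d (charge_of_finite_measure p) '/d q], which may be negative on a null
   set. *)
Definition density p q : T -> R :=
  fun x => fine (Radon_Nikodym_SigmaFinite.f p q x).

Definition bounded_density p q : Prop :=
  exists K : R, {ae q, forall x, density p q x <= K}.

(* Only the values of phi on [0, +oo[ matter, density being nonnegative. *)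
Definition phi_divergence (phi : R -> R) p q : \bar R :=
  (\int[q]_x (phi (density p q x))%:E)%E.

Definition crossing_null p p' q (e0 : R) : Prop :=
  q [set x | density p' q x <= density p q x < e0] = 0%E.

Definition admissible_dominating (M : set (probability T R)) p p' q : Prop :=
  [/\ M q, p `<< q,
      p' `<< q /\ bounded_density p' q &
      exists e0 : R, 0 < e0 <= 1 /\ crossing_null p p' q e0].

End divergence.

Definition strict_local_max_at_1 (R : realType) (f : {i01 R} -> \bar R) :
    Prop :=
  exists2 delta : R, 0 < delta &
    forall l : {i01 R}, 1 - delta < l%:num < 1 -> (f l < f 1%:i01%R)%E.

(* Main.v *)
Require Import Defs.
From HB Require Import structures.
From mathcomp Require Import all_boot all_order all_algebra.
From mathcomp Require Import interval_inference.
From mathcomp Require Import all_classical all_reals all_analysis.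
From mathcomp Require Import measurable_realfun ring lra.

Set Implicit Arguments.
Unset Strict Implicit.
Unset Printing Implicit Defensive.

Import Order.TTheory GRing.Theory Num.Theory.
Import numFieldNormedType.Exports.

Local Open Scope classical_set_scope.
Local Open Scope ring_scope.

(** Why the theorem holds.  All four statements amount to: p cannot be moved
    inside M away from some p', beyond p itself, and still stay in M.

    Extremality versus bounded densities.  If p is a proper mixture
    l p' + (1 - l) p'', then p' <= l^-1 p, so p' has a bounded density.
    Conversely, a p' in M with p' <= K p leaves room for the signed measure
    r = (p - t p') / (1 - t), with t = 1 / K, to be nonnegative; since H is
    affine, r lies in M and p is a proper mixture of p' and r
    ([affine_extrapolation]).

    Change of dominating measure.  Whatever q is, the inequality
    (1 + e) dp/dq - e dp'/dq >= 0 says e p' <= (1 + e) p setwise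
    ([scaled_density_leP]), which bounds dp'/dp by (1 + e) / e.

    Divergences.  Let f = dp/dq, g = dp'/dq and h = l f + (1 - l) g with l
    close to 1.  Where f >= e0, h stays above a, so that phi f = phi h = 0.
    Where f < e0, admissibility gives g > f, hence h > f and
    phi h <= phi f, strictly where phi f > 0, because a convex function that
    vanishes from a on is strictly decreasing where it is positive.  Thus the
    divergence strictly decreases when leaving l = 1, unless phi f = 0 almost
    everywhere.  In that case f is bounded away from 0 by continuity of phi at
    0, and since g is bounded, p can be extrapolated away from p', which is
    excluded ([no_extrapolation_strict_max]).

    Conversely, if p is a proper mixture involving p', take q := p.  Then
    dp/dq = 1, so p is admissible for p', but with phi x = max (1/2 - x) 0 the
    divergence vanishes for all l >= 1/2 and l = 1 is not a strict maximizer
    ([strict_max_extreme]). *)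

(** * Almost everywhere comparison by integrals *)

Section integral_comparison.
Context d (T : measurableType d) (R : realType).
Variable (mu : {measure set T -> \bar R}).
Implicit Types (D : set T) (u v : T -> R).

(** As the inequality only holds almost everywhere, v is replaced by
    max u v, which is above u at every point and has the same integral. *)
Lemma ae_eq_of_integral_le D u v : measurable D ->
    mu.-integrable D (EFin \o u) -> mu.-integrable D (EFin \o v) ->
    {ae mu, forall x, D x -> u x <= v x} ->
    (\int[mu]_(x in D) (v x)%:E <= \int[mu]_(x in D) (u x)%:E)%E ->
  {ae mu, forall x, D x -> u x = v x}.
Proof.
move=> mD iu iv uv ivu.
pose w x := Num.max (u x) (v x).
have mfu : measurable_fun D u.
  by apply/measurable_EFinP; exact: measurable_int iu.
have mfv : measurable_fun D v.
  by apply/measurable_EFinP; exact: measurable_int iv.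
have mw : measurable_fun D w by exact: measurable_maxr.
have wv : ae_eq mu D (EFin \o v) (EFin \o w).
  by apply: filterS uv => x /= + Dx => /(_ Dx) /max_idPr; rewrite /w => ->.
have mwE : measurable_fun D (EFin \o w) by exact/measurable_EFinP.
have intw : (\int[mu]_(x in D) (w x)%:E = \int[mu]_(x in D) (v x)%:E)%E.
  by apply/esym/ae_eq_integral => //; exact/measurable_EFinP.
have iw : mu.-integrable D (EFin \o w).
  apply/integrableP; split=> //.
  have <- : (\int[mu]_(x in D) `|(EFin \o v) x| =
             \int[mu]_(x in D) `|(EFin \o w) x|)%E.
    apply: ae_eq_integral; [exact: mD|exact/measurableT_comp/measurable_int/iv
      |exact: measurableT_comp|exact: ae_eq_abse].
  by have /integrableP[] := iv.
have w_u x : 0 <= w x - u x by rewrite subr_ge0 le_max lexx.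
have wu0 : ae_eq mu D (EFin \o (w \- u)) (cst 0%E).
  apply/ae_eq_integral_abs => //.
    by apply/measurable_EFinP; exact: measurable_funB.
  under eq_integral do rewrite /= ger0_norm//.
  apply/eqP; rewrite eq_le; apply/andP; split; last first.
    by apply: integral_ge0 => x _; rewrite lee_fin.
  under eq_integral do rewrite EFinB.
  rewrite integralB_EFin// intw leeBlDr ?add0e//.
  exact: integrable_fin_num.
apply: filterS2 wv wu0 => x vw wu Dx.
have [{}vw] := vw Dx; have [/eqP] := wu Dx.
by rewrite /= -vw subr_eq0 => /eqP.
Qed.

(** On the set where v < u, the hypothesis forces u and v to be equal almost
    everywhere, so that set is null. *)
Lemma ae_le_of_integral_le u v :
    mu.-integrable setT (EFin \o u) -> mu.-integrable setT (EFin \o v) ->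
    (forall A, measurable A ->
      (\int[mu]_(x in A) (u x)%:E <= \int[mu]_(x in A) (v x)%:E)%E) ->
  {ae mu, forall x, u x <= v x}.
Proof.
move=> iu iv uv.
have mfu : measurable_fun setT u.
  by apply/measurable_EFinP; exact: measurable_int iu.
have mfv : measurable_fun setT v.
  by apply/measurable_EFinP; exact: measurable_int iv.
have mA : measurable [set x | v x < u x].
  by rewrite -[X in measurable X]setTI; exact: measurable_fun_ltr.
have : {ae mu, forall x, [set x | v x < u x] x -> v x = u x}.
  apply: ae_eq_of_integral_le => //.
  - exact: integrableS iv.
  - exact: integrableS iu.
  - by apply: aeW => x /= /ltW.
  - exact: uv.
apply: filterS => x /= vu; rewrite leNgt; apply/negP => xvu.
by move: (xvu); rewrite vu// ltxx.
Qed.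

End integral_comparison.

(** * Densities between probability measures *)

Section densities.
Context d (T : measurableType d) (R : realType).
Implicit Types p q : probability T R.

Lemma density_ge0 p q x : 0 <= density p q x.
Proof.
(* Without absolute continuity the density is the constant [fine -oo] = 0. *)
have [pq|npq] := pselect (p `<< q).
  by rewrite fine_ge0// Radon_Nikodym_SigmaFinite.f_ge0.
by rewrite /density /Radon_Nikodym_SigmaFinite.f; case: pselect.
Qed.

Lemma EFin_density p q : p `<< q ->
  EFin \o density p q = Radon_Nikodym_SigmaFinite.f p q.
Proof.
move=> pq; apply/funext => x /=.
by rewrite fineK// Radon_Nikodym_SigmaFinite.f_fin_num.
Qed.

Lemma integrable_density p q : p `<< q ->
  q.-integrable setT (EFin \o density p q).
Proof.
move=> pq; rewrite EFin_density//.
exact: Radon_Nikodym_SigmaFinite.f_integrable.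
Qed.

Lemma measurable_density p q : p `<< q -> measurable_fun setT (density p q).
Proof.
move=> pq; apply/measurable_EFinP.
exact: measurable_int (integrable_density pq).
Qed.

Lemma integral_density p q A : p `<< q -> measurable A ->
  (\int[q]_(x in A) (density p q x)%:E = p A)%E.
Proof.
move=> pq mA; rewrite (Radon_Nikodym_SigmaFinite.f_integral pq mA).
by rewrite -EFin_density.
Qed.

Lemma density_unique p q (h : T -> R) : p `<< q ->
    q.-integrable setT (EFin \o h) ->
    (forall A, measurable A -> (\int[q]_(x in A) (h x)%:E = p A)%E) ->
  {ae q, forall x, density p q x = h x}.
Proof.
move=> pq ih hE; have id := integrable_density pq.
have : ae_eq q setT (EFin \o density p q) (EFin \o h).
  apply: integral_ae_eq => //; first exact: measurable_int ih.
  by move=> A _ mA; rewrite integral_density// -hE.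
by apply: filterS => x /(_ Logic.I) [].
Qed.

Lemma density_refl p : {ae p, forall x, density p p x = 1}.
Proof.
apply: density_unique => //.
  exact: finite_measure_integrable_cst.
by move=> A mA; rewrite integral_cst// mul1e.
Qed.

Lemma scaled_integral_density p q (a : R) A : p `<< q -> measurable A ->
  (\int[q]_(x in A) (a * density p q x)%:E = a%:E * p A)%E.
Proof.
move=> pq mA; rewrite -(integral_density pq mA) -integralZl//.
exact: integrableS (integrable_density pq).
Qed.

Lemma integrable_scaled_density p q (a : R) : p `<< q ->
  q.-integrable setT (EFin \o (fun x => a * density p q x)).
Proof. by move=> pq; exact: integrableZl (integrable_density pq). Qed.

Lemma mixture_dominated (l : {i01 R}) p p' q : p `<< q -> p' `<< q ->
  mixture l p p' `<< q.
Proof.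
move=> pq p'q A nA B mB BA.
by rewrite [LHS]mixtureE (pq _ nA)// (p'q _ nA)// !mule0 adde0.
Qed.

Lemma density_mixture p p' q (l : {i01 R}) : p `<< q -> p' `<< q ->
  {ae q, forall x, density (mixture l p p') q x =
                   l%:num * density p q x + (1 - l%:num) * density p' q x}.
Proof.
move=> pq p'q; apply: density_unique.
- exact: mixture_dominated.
- exact: (integrableD measurableT (integrable_scaled_density l%:num pq)
                                  (integrable_scaled_density (1 - l%:num) p'q)).
- move=> A mA; rewrite [RHS]mixtureE.
  under eq_integral do rewrite EFinD.
  rewrite integralD_EFin//.
  + by rewrite !scaled_integral_density.
  + exact: integrableS (integrable_scaled_density _ _).
  + exact: integrableS (integrable_scaled_density _ _).
Qed.

(** Serves to change the dominating measure: an inequality between densities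
    with respect to q passes, through its setwise form, to densities with
    respect to any other dominating measure, in particular p itself. *)
Lemma scaled_density_leP p p' q (a b : R) : 0 <= a -> 0 <= b ->
    p `<< q -> p' `<< q ->
  {ae q, forall x, a * density p' q x <= b * density p q x} <->
  (forall A, measurable A -> (a%:E * p' A <= b%:E * p A)%E).
Proof.
move=> a0 b0 pq p'q; split=> [ab A mA|ab].
  rewrite -(scaled_integral_density _ pq)// -(scaled_integral_density _ p'q)//.
  apply: ae_ge0_le_integral => //.
  - by move=> x _; rewrite lee_fin mulr_ge0// density_ge0.
  - apply/measurable_EFinP/measurable_funTS.
    by apply: measurable_funM => //; exact: measurable_density.
  - by move=> x _; rewrite lee_fin mulr_ge0// density_ge0.
  - apply/measurable_EFinP/measurable_funTS.
    by apply: measurable_funM => //; exact: measurable_density.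
  - by apply: filterS ab => x ? _; rewrite lee_fin.
apply: ae_le_of_integral_le; [exact: integrable_scaled_density..|].
by move=> A mA; rewrite !scaled_integral_density//; exact: ab.
Qed.

Lemma bounded_density_setwise p p' (a b : R) : 0 < a -> 0 <= b ->
    (forall A, measurable A -> (a%:E * p' A <= b%:E * p A)%E) ->
  p' `<< p /\ bounded_density p' p.
Proof.
move=> a0 b0 ab.
have p'p : p' `<< p.
  apply/null_content_dominatesP => A mA pA0.
  have := ab A mA; rewrite pA0 mule0 => p'A.
  apply/eqP; rewrite eq_le measure_ge0 andbT.
  by rewrite -(@pmule_rle0 _ a%:E).
split=> //; exists (b / a).
have : {ae p, forall x, a * density p' p x <= b * density p p x}.
  by apply/scaled_density_leP => //; exact: ltW.
apply: filterS2 (density_refl p) => x ->.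
by rewrite mulr1 ler_pdivlMr// mulrC.
Qed.

Lemma crossing_nullP p p' q (e0 : R) : p `<< q -> p' `<< q ->
  crossing_null p p' q e0 <->
  {ae q, forall x, density p q x < e0 -> density p q x < density p' q x}.
Proof.
move=> pq p'q.
pose S := [set x | density p' q x <= density p q x < e0].
have mS : measurable S.
  rewrite (_ : S = [set x | density p' q x <= density p q x] `&`
                   [set x | density p q x < e0]).
    apply: measurableI; rewrite -[X in measurable X]setTI.
    - by apply: measurable_fun_ler => //; exact: measurable_density.
    - by apply: measurable_fun_ltr => //; exact: measurable_density.
  by apply/seteqP; rewrite /S; split=> x /= => [/andP[]|[-> ->]].
rewrite /crossing_null -(negligibleP _ mS) /S.
split=> [[N [mN N0 SN]]|[N [mN N0 SN]]]; exists N; split=> //;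
    apply: subset_trans SN => x /=.
  by move=> /not_implyP[fe0 /negP]; rewrite -leNgt fe0 andbT.
by move=> /andP[gf fe0] /(_ fe0); rewrite ltNge gf.
Qed.

End densities.

(** * The conditions on a point of a set of probability measures *)

Section conditions.
Context d (T : measurableType d) (R : realType).
Implicit Types (M : set (probability T R)) (p : probability T R).

Definition no_bounded_density M p : Prop :=
  ~ exists p' : probability T R,
      [/\ M p', ~ eq_on_measurable p' p, p' `<< p & bounded_density p' p].

Definition no_bounded_extrapolation M p : Prop :=
  forall (q : probability T R) (e : R), M q -> p `<< q -> 0 < e < 1 ->
    ~ exists p' : probability T R,
        [/\ M p' /\ ~ eq_on_measurable p' p, p' `<< q, bounded_density p' q &
            {ae q, forall x,
               0 <= (1 + e) * density p q x - e * density p' q x}].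

Definition strict_divergence_maximum M p : Prop :=
  forall p' : probability T R, M p' -> ~ eq_on_measurable p' p ->
  forall q : probability T R, admissible_dominating M p p' q ->
  forall e0 : R, 0 < e0 <= 1 -> crossing_null p p' q e0 ->
  forall phi : R -> R,
    {within `[0, +oo[, continuous phi} ->
    convex_function (`[0, +oo[%classic : set (convex_lmodType R^o)) phi ->
    (forall x, 0 <= x -> 0 <= phi x) ->
    0 < phi 0 ->
    (exists a : R, 0 < a < e0 /\ forall x, a <= x -> phi x = 0) ->
    strict_local_max_at_1
      (fun l : {i01 R} => phi_divergence phi (mixture l p p') q).

End conditions.

(** * Extrapolation in an affine set *)

Section probability_of_charge.
Context d (T : measurableType d) (R : realType).
Variables (c : {charge set T -> \bar R}).
Hypothesis c_ge0 : forall A, measurable A -> (0 <= c A)%E.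

Let c_ge0_all A : (0 <= crestr0 c measurableT A)%E.
Proof.
by rewrite /crestr0; case: ifPn => // /set_mem mA; rewrite /crestr setIT c_ge0.
Qed.

(** A measure has to be nonnegative on every subset of T, but c is controlled
    on measurable sets only: [crestr0] replaces its other values by 0.  The
    proof that c has mass 1 is an argument so that the instance of probability
    measure below can be inferred from the term. *)
Definition probability_of_charge (_ : c setT = 1%E) : set T -> \bar R :=
  measure_of_charge _ c_ge0_all.

Hypothesis cT : c setT = 1%E.

HB.instance Definition _ := Measure.on (probability_of_charge cT).

Lemma probability_of_chargeE A : measurable A ->
  probability_of_charge cT A = c A.
Proof.
move=> mA; rewrite /probability_of_charge /measure_of_charge /crestr0.
by rewrite mem_set// /crestr setIT.
Qed.

Let probability_of_chargeT : probability_of_charge cT setT = 1%E.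
Proof. by rewrite probability_of_chargeE. Qed.

HB.instance Definition _ := Measure_isProbability.Build _ _ _
  (probability_of_charge cT) probability_of_chargeT.

End probability_of_charge.

Section affine_extrapolation.
Context d (T : measurableType d) (R : realType).
Variable H : set ({charge set T -> \bar R}).
Hypothesis H_affine : affine_set H.
Implicit Types p q : probability T R.

(** The measure r = (p - t p') / (1 - t) is the affine combination of p and p'
    with coefficients s and 1 - s for s = 1 / (1 - t); the inequality
    t p' <= p is what makes it nonnegative. *)
Lemma affine_extrapolation p p' (t : {i01 R}) : t%:num < 1 ->
    probabilities_in H p -> probabilities_in H p' ->
    (forall A, measurable A -> (t%:num%:E * p' A <= p A)%E) ->
  exists r : probability T R,
    probabilities_in H r /\ eq_on_measurable p (mixture t p' r).
Proof.
move=> t1 Hp Hp' tp'p; have [Hext Haff] := H_affine.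
pose s := (1 - t%:num)^-1.
have t1' : 1 - t%:num != 0 by rewrite subr_eq0 gt_eqF.
pose c : {charge set T -> \bar R} :=
  cadd (cscale s (charge_of_finite_measure p))
       (cscale (1 - s) (charge_of_finite_measure p')).
have cE A : measurable A ->
    c A = (s * (fine (p A) - t%:num * fine (p' A)))%:E.
  move=> mA; have -> : c A = (s%:E * p A + (1 - s)%:E * p' A)%E by [].
  have /fineK <- := fin_num_measure p A mA.
  have /fineK <- := fin_num_measure p' A mA.
  rewrite -!EFinM -EFinD; congr EFin; rewrite /s.
  by field.
have c0 A : measurable A -> (0 <= c A)%E.
  move=> mA; rewrite cE// lee_fin mulr_ge0//.
    by rewrite invr_ge0 subr_ge0 ltW.
  rewrite subr_ge0 -lee_fin EFinM !fineK ?fin_num_measure//.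
  exact: tp'p.
have cT : c setT = 1%E.
  by rewrite cE// !probability_setT/= mulr1 mulVf.
exists (probability_of_charge c0 cT); split.
  apply: (Hext c); last exact: Haff.
  by move=> A mA; rewrite /charge_of_finite_measure [RHS]probability_of_chargeE.
move=> A mA; rewrite [RHS]mixtureE.
rewrite [X in (_ + _ * X)%E]probability_of_chargeE// cE//.
have /fineK pA := fin_num_measure p A mA.
have /fineK p'A := fin_num_measure p' A mA.
rewrite -[in LHS]pA -[in X in (X + _)%E]p'A.
rewrite -!EFinM -EFinD; congr EFin; rewrite /s.
by field.
Qed.

Lemma extreme_no_bounded_density p : extreme_point (probabilities_in H) p ->
  no_bounded_density (probabilities_in H) p.
Proof.
move=> [Hp ext] [p' [Hp' p'p domp'p [K p'K]]].
pose K1 := Num.max K 2.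
have K1_gt1 : 1 < K1 by rewrite lt_max ltr1n orbT.
have K1_gt0 : 0 < K1 := lt_trans ltr01 K1_gt1.
have t0 : 0 <= K1^-1 by rewrite invr_ge0 ltW.
have t1 : K1^-1 < 1 by rewrite invf_lt1.
pose t := Itv01 t0 (ltW t1).
have tp'p A : measurable A -> (t%:num%:E * p' A <= p A)%E.
  move=> mA; rewrite -[leRHS]mul1e; move: A mA.
  apply/(@scaled_density_leP _ _ _ _ _ p) => //.
  apply: filterS2 p'K (density_refl p) => x gK ->.
  by rewrite mulr1 mulrC ler_pdivrMr// mul1r le_max gK.
have [//|r [Hr pE]] := affine_extrapolation _ Hp Hp' tp'p.
have [|//] := ext p' r t Hp' Hr _ pE.
by rewrite /= t1 invr_gt0 K1_gt0.
Qed.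

End affine_extrapolation.

Section domination.
Context d (T : measurableType d) (R : realType).
Implicit Types (M : set (probability T R)) (p q : probability T R).

Lemma no_bounded_density_no_extrapolation M p :
  no_bounded_density M p -> no_bounded_extrapolation M p.
Proof.
move=> nobd q e _ pq /andP[e0 _] [p' [[Mp' p'p] p'q _ ext]]; apply: nobd.
have e1 : 0 <= 1 + e by rewrite addr_ge0// ltW.
have dom A : measurable A -> (e%:E * p' A <= (1 + e)%:E * p A)%E.
  move: A; apply/(@scaled_density_leP _ _ _ _ _ q) => //; first exact: ltW.
  by apply: filterS ext => x; rewrite subr_ge0.
by have [] := bounded_density_setwise e0 e1 dom; exists p'.
Qed.

End domination.

(** * Convex functions vanishing from some point on *)

Section convex_vanishing.
Context (R : realType).
Variables (phi : R -> R) (a : R).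
Hypotheses (phi_convex :
    convex_function (`[0, +oo[%classic : set (convex_lmodType R^o)) phi)
  (phi_ge0 : forall x, 0 <= x -> 0 <= phi x)
  (a_gt0 : 0 < a) (phi_a : forall x, a <= x -> phi x = 0).

(** The graph of phi lies below the chord from (x, phi x) to (a, 0). *)
Lemma convex_vanishing_chord x y : 0 <= x -> x < y ->
  exists2 t : R, 0 <= t < 1 & phi y <= t * phi x.
Proof.
move=> x0 xy; have [ay|ya] := leP a y.
  by exists 0; rewrite ?lexx ?ltr01// phi_a// mul0r.
have xa := lt_trans xy ya.
have ax0 : 0 < a - x by rewrite subr_gt0.
pose t := (a - y) / (a - x).
have t0 : 0 <= t by rewrite divr_ge0 ?subr_ge0// ltW.
have t1 : t < 1 by rewrite ltr_pdivrMr// mul1r ler_ltB.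
exists t; first by rewrite t0 t1.
have xD : x \in (`[0, +oo[%classic : set (convex_lmodType R^o)).
  by rewrite inE /= in_itv/= x0.
have aD : a \in (`[0, +oo[%classic : set (convex_lmodType R^o)).
  by rewrite inE /= in_itv/= ltW.
have : phi (t * x + (1 - t) * a) <= t * phi x + (1 - t) * phi a.
  exact: (phi_convex (Itv01 t0 (ltW t1)) xD aD).
have -> : t * x + (1 - t) * a = y.
  by rewrite /t; field; rewrite gt_eqF.
by rewrite (phi_a (lexx a)) mulr0 addr0.
Qed.

Lemma convex_vanishing_nonincreasing x y : 0 <= x -> x <= y -> phi y <= phi x.
Proof.
move=> x0; rewrite le_eqVlt => /predU1P[->//|xy].
have [t /andP[t0 t1] h] := convex_vanishing_chord x0 xy.
by rewrite (le_trans h)// ler_piMl ?phi_ge0// ltW.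
Qed.

Lemma convex_vanishing_decreasing x y : 0 <= x -> x < y -> 0 < phi x ->
  phi y < phi x.
Proof.
move=> x0 xy phix; have [t /andP[t0 t1] h] := convex_vanishing_chord x0 xy.
by rewrite (le_lt_trans h)// gtr_pMl.
Qed.

End convex_vanishing.

Section hockey_stick.
Context (R : realType).

(** A convex test function that vanishes around 1, the value of the density of
    p with respect to itself. *)
Definition hockey_stick (x : R) : R := Num.max (2^-1 - x) 0.

Lemma hockey_stick_ge0 x : 0 <= hockey_stick x.
Proof. by rewrite /hockey_stick le_max lexx orbT. Qed.

Lemma hockey_stick_eq0 x : 2^-1 <= x -> hockey_stick x = 0.
Proof. by move=> hx; apply/max_idPr; rewrite subr_le0. Qed.

Lemma hockey_stick_continuous : continuous hockey_stick.
Proof.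
move=> x; apply: (@continuous_max R R (fun x => 2^-1 - x) (cst 0)).
  by apply: continuousB; [exact: cvg_cst|exact: cvg_id].
exact: cvg_cst.
Qed.

Lemma hockey_stick_convex (D : set (convex_lmodType R^o)) :
  convex_function D hockey_stick.
Proof.
move=> t x y _ _.
suff : hockey_stick (t%:num * x + (1 - t%:num) * y) <=
       t%:num * hockey_stick x + (1 - t%:num) * hockey_stick y by [].
have t1 : 0 <= 1 - t%:num by rewrite subr_ge0.
rewrite {1}/hockey_stick ge_max addr_ge0 ?mulr_ge0 ?hockey_stick_ge0// andbT.
have -> : 2^-1 - (t%:num * x + (1 - t%:num) * y) =
  t%:num * (2^-1 - x) + (1 - t%:num) * (2^-1 - y) by ring.
by rewrite lerD// ler_wpM2l// /hockey_stick le_max lexx.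
Qed.

End hockey_stick.

(** * Divergences of mixtures *)

Section divergence_of_mixture.
Context d (T : measurableType d) (R : realType).
Implicit Types (p q : probability T R) (phi : R -> R).

Lemma measurable_comp_ge0 phi (h : T -> R) :
    {within `[0, +oo[, continuous phi} ->
    measurable_fun setT h -> (forall x, 0 <= h x) ->
  measurable_fun setT (phi \o h).
Proof.
move=> phi_cont mh h0.
have mphi := subspace_continuous_measurable_fun (measurable_itv _) phi_cont.
apply: (measurable_comp (measurable_itv _) _ mphi mh).
by move=> _ [x _ <-]; rewrite /= in_itv/= h0.
Qed.

Lemma mixed_density_ge0 (l : {i01 R}) p p' q x :
  0 <= l%:num * density p q x + (1 - l%:num) * density p' q x.
Proof. by rewrite addr_ge0// mulr_ge0 ?density_ge0// subr_ge0. Qed.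

Lemma measurable_mixed_density (l : {i01 R}) p p' q : p `<< q -> p' `<< q ->
  measurable_fun setT
    (fun x => l%:num * density p q x + (1 - l%:num) * density p' q x).
Proof.
move=> pq p'q; apply: measurable_funD; apply: measurable_funM => //;
  exact: measurable_density.
Qed.

Lemma phi_divergence_mixture phi (l : {i01 R}) p p' q :
    {within `[0, +oo[, continuous phi} -> p `<< q -> p' `<< q ->
  phi_divergence phi (mixture l p p') q =
  (\int[q]_x
    (phi (l%:num * density p q x + (1 - l%:num) * density p' q x))%:E)%E.
Proof.
move=> phi_cont pq p'q; apply: ae_eq_integral => //.
- apply/measurable_EFinP; apply: measurable_comp_ge0 => //.
  + exact/measurable_density/mixture_dominated.
  + by move=> x; exact: density_ge0.
- apply/measurable_EFinP; apply: measurable_comp_ge0 => //.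
  + exact: measurable_mixed_density.
  + by move=> x; exact: mixed_density_ge0.
by apply: filterS (density_mixture l pq p'q) => x -> _.
Qed.

End divergence_of_mixture.

(** * Strict maximality at an extreme point *)

Section strict_maximum.
Context d (T : measurableType d) (R : realType).
Implicit Types (M : set (probability T R)) (p q : probability T R).

(** Any e with 0 < e <= b / K works when K > 0 bounds the density of p'. *)
Lemma extrapolation_of_density_gt0 p p' q (b : R) : 0 < b ->
    bounded_density p' q -> {ae q, forall x, b <= density p q x} ->
  exists2 e : R, 0 < e < 1 &
    {ae q, forall x, 0 <= (1 + e) * density p q x - e * density p' q x}.
Proof.
move=> b0 [K p'K] bp.
pose K1 := Num.max K 1.
have K1_gt0 : 0 < K1 by rewrite lt_max ltr01 orbT.
pose e := Num.min 2^-1 (b / K1).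
have e0 : 0 < e by rewrite lt_min invr_gt0 ltr0n divr_gt0.
exists e; first by rewrite e0 gt_min invf_lt1 ?ltr1n.
apply: filterS2 p'K bp => x gK bf; rewrite subr_ge0.
have h1 : e * density p' q x <= b.
  rewrite (@le_trans _ _ (e * K1))//.
    by rewrite ler_wpM2l ?(ltW e0)// le_max gK.
  by rewrite -ler_pdivlMr// ge_min lexx orbT.
rewrite (le_trans h1)// (le_trans bf)// ler_peMl ?density_ge0//.
by rewrite lerDl ltW.
Qed.

Lemma positive_near_0 (phi : R -> R) :
    {within `[0, +oo[, continuous phi} -> 0 < phi 0 ->
  exists2 b : R, 0 < b & forall x, 0 <= x < b -> 0 < phi x.
Proof.
move=> /continuous_within_itvcyP[_ phi_cvg] phi0.
have [b /= b0 hb] := cvgr_gt _ phi_cvg _ phi0.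
exists b => // x /andP[]; rewrite le_eqVlt => /predU1P[<-//|x0] xb.
by apply: hb => //=; rewrite sub0r normrN gtr0_norm.
Qed.

Lemma no_extrapolation_strict_max M p :
  no_bounded_extrapolation M p -> strict_divergence_maximum M p.
Proof.
move=> noext p' Mp' p'p q [Mq pq [p'q bd] _] e0 /andP[e0_gt0 _] cross.
move=> phi phi_cont phi_convex phi_ge0 phi0 [a [/andP[a0 ae0] phia]].
have dec := convex_vanishing_decreasing phi_convex a0 phia.
have noninc := convex_vanishing_nonincreasing phi_convex phi_ge0 a0 phia.
(* For l > a / e0, the mixture has h >= l e0 > a wherever f >= e0. *)
exists (1 - a / e0); first by rewrite subr_gt0 ltr_pdivrMr// mul1r.
move=> l /andP[]; rewrite opprB addrCA subrr addr0 => al l1.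
have ale0 : a < l%:num * e0 by rewrite -ltr_pdivrMr.
rewrite !phi_divergence_mixture//.
set f := density p q; set g := density p' q.
pose h x := l%:num * f x + (1 - l%:num) * g x.
have hf x : 1 * f x + (1 - 1) * g x = f x by rewrite subrr mul0r addr0 mul1r.
under [ltRHS]eq_integral do rewrite hf.
have f0 x : 0 <= f x by exact: density_ge0.
have h0 x : 0 <= h x by exact: mixed_density_ge0.
have mf : measurable_fun setT f by exact: measurable_density.
have mg : measurable_fun setT g by exact: measurable_density.
have mh : measurable_fun setT h by exact: measurable_mixed_density.
have integrable_phi (k : T -> R) :
    measurable_fun setT k -> (forall x, 0 <= k x) ->
    q.-integrable setT (EFin \o (phi \o k)).
  move=> mk k0; apply: (measurable_bounded_integrable (mu := q)) => //.
  - by rewrite -ge0_fin_numE ?fin_num_measure.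
  - exact: measurable_comp_ge0.
  - exists (phi 0); split; first exact: num_real.
    move=> M0 phiM x _ /=; rewrite ger0_norm ?phi_ge0//.
    by rewrite (le_trans _ (ltW phiM))// noninc.
have /(crossing_nullP _ pq p'q) fg := cross.
have fh x : f x < g x -> f x < h x.
  move=> fgx; rewrite /h.
  have : 0 < (1 - l%:num) * (g x - f x) by rewrite mulr_gt0 ?subr_gt0.
  by lra.
have fbig x : e0 <= f x -> phi (f x) = 0.
  by move=> ef; rewrite phia// (le_trans _ ef)// ltW.
have hbig x : e0 <= f x -> phi (h x) = 0.
  move=> ef; rewrite phia// (le_trans (ltW ale0))//.
  rewrite (@le_trans _ _ (l%:num * f x))// ?ler_wpM2l//.
  by rewrite lerDl mulr_ge0 ?density_ge0// subr_ge0.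
have phihf : {ae q, forall x, setT x -> phi (h x) <= phi (f x)}.
  apply: filterS fg => x fe0g _.
  have [fe0|e0f] := ltP (f x) e0.
    by apply: noninc => //; exact/ltW/fh/fe0g.
  by rewrite hbig// fbig.
(* If the inequality of integrals is not strict, phi h = phi f almost
   everywhere, which is only possible where phi f = 0. *)
rewrite ltNge; apply/negP => le_int.
have phi_eq := ae_eq_of_integral_le measurableT
  (integrable_phi _ mh h0) (integrable_phi _ mf f0) phihf le_int.
have [b b0 phib] := positive_near_0 phi_cont phi0.
have bf : {ae q, forall x, b <= f x}.
  apply: filterS2 fg phi_eq => x fe0g /(_ Logic.I) /= phihfx.
  rewrite leNgt; apply/negP => fb.
  have phif : 0 < phi (f x) by rewrite phib// f0.
  have [fe0|e0f] := ltP (f x) e0.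
    have := dec _ _ (f0 x) (fh _ (fe0g fe0)) phif.
    by rewrite phihfx ltxx.
  by move: phif; rewrite fbig// ltxx.
have [e e01 ext] := extrapolation_of_density_gt0 b0 bd bf.
by apply: (noext q e Mq pq e01); exists p'.
Qed.

(** The density of p with respect to q := p is 1, hence that of the mixture is
    at least l, and the hockey-stick divergence is 0 for all l >= 1/2. *)
Lemma strict_max_setwise_le M p p' (b : R) : M p ->
    strict_divergence_maximum M p -> M p' -> 0 < b ->
    (forall A, measurable A -> (b%:E * p' A <= p A)%E) ->
  eq_on_measurable p' p.
Proof.
move=> Mp smax Mp' b0 bp'p; apply: contrapT => p'p.
have [p'_p bd] : p' `<< p /\ bounded_density p' p.
  apply: (bounded_density_setwise b0 (@ler01 R)) => A mA.
  by rewrite mul1e bp'p.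
have pp : p `<< p by [].
have cross : crossing_null p p' p 1.
  apply/crossing_nullP => //.
  by apply: filterS (density_refl p) => x ->; rewrite ltxx.
have adm : admissible_dominating M p p' p.
  by split=> //; exists 1; rewrite ltr01 lexx.
have [|||d0 d0_gt0 /=] := smax p' Mp' p'p p adm 1 _ cross
    (@hockey_stick R) (continuous_subspaceT (@hockey_stick_continuous R))
    (@hockey_stick_convex R _) (fun x _ => hockey_stick_ge0 x).
- by rewrite ltr01 lexx.
- by rewrite /hockey_stick subr0 lt_max invr_gt0 ltr0n.
- exists 2^-1; rewrite invr_gt0 ltr0n invf_lt1 ?ltr1n//.
  by split=> // x; exact: hockey_stick_eq0.
pose m : R := Num.min 2^-1 (d0 / 2).
have m0 : 0 < m by rewrite lt_min invr_gt0 ltr0n divr_gt0.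
have m_half : m <= 2^-1 by rewrite ge_min lexx.
have m_d0 : m <= d0 / 2 by rewrite ge_min lexx orbT.
have s_half : 2^-1 <= 1 - m by lra.
have s0 : 0 <= 1 - m by rewrite (le_trans _ s_half)// invr_ge0.
have s1 : 1 - m < 1 by lra.
move=> /(_ (Itv01 s0 (ltW s1))) /=.
have -> : 1 - d0 < 1 - m < 1 by rewrite s1 andbT; lra.
move=> /(_ isT).
have zero (l : {i01 R}) : 2^-1 <= l%:num ->
    phi_divergence (@hockey_stick R) (mixture l p p') p = 0%E.
  move=> l_half; have stick_cont := @hockey_stick_continuous R.
  rewrite phi_divergence_mixture//; last exact: continuous_subspaceT.
  rewrite -[RHS](integral0 p setT); apply: ae_eq_integral => //.
    apply/measurable_EFinP; apply: measurable_comp_ge0 => //.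
    - exact: continuous_subspaceT.
    - exact: measurable_mixed_density.
    - by move=> x; exact: mixed_density_ge0.
  apply: filterS (density_refl p) => x -> _; rewrite hockey_stick_eq0//.
  by rewrite mulr1 (le_trans l_half)// lerDl mulr_ge0 ?density_ge0// subr_ge0.
rewrite !zero ?ltxx//=.
by rewrite invf_le1 ?ler1n.
Qed.

Lemma strict_max_extreme M p : M p ->
  strict_divergence_maximum M p -> extreme_point M p.
Proof.
move=> Mp smax.
split=> // p' p'' l Mp' Mp'' /andP[l0 l1] pE.
split.
  apply: (strict_max_setwise_le (b := l%:num) Mp) => // A mA.
  rewrite pE// [leRHS]mixtureE leeDl//.
  by rewrite mule_ge0// lee_fin subr_ge0.
apply: (strict_max_setwise_le (b := 1 - l%:num) Mp) => //.
  by rewrite subr_gt0.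
move=> A mA; rewrite pE// [leRHS]mixtureE leeDr//.
by rewrite mule_ge0.
Qed.

End strict_maximum.

(** * The equivalence *)

Theorem theorem2p11 (d : measure_display) (T : measurableType d) (R : realType)
    (H : set ({charge set T -> \bar R})) (H_affine : affine_set H)
    (M_nonempty : probabilities_in H !=set0)
    (p : probability T R) (p_in : probabilities_in H p) :
  let M := probabilities_in H in
  [<->
    (* (i) *)
    extreme_point M p;
    (* (ii) *)
    ~ exists p' : probability T R,
        [/\ M p', ~ eq_on_measurable p' p, p' `<< p & bounded_density p' p];
    (* (iii) *)
    forall (q : probability T R) (e : R), M q -> p `<< q -> 0 < e < 1 ->
      ~ exists p' : probability T R,
          [/\ M p' /\ ~ eq_on_measurable p' p, p' `<< q, bounded_density p' q &
              {ae q, forall x,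
                 0 <= (1 + e) * density p q x - e * density p' q x}];
    (* (iv) *)
    forall p' : probability T R, M p' -> ~ eq_on_measurable p' p ->
    forall q : probability T R, admissible_dominating M p p' q ->
    forall e0 : R, 0 < e0 <= 1 -> crossing_null p p' q e0 ->
    forall phi : R -> R,
      {within `[0, +oo[, continuous phi} ->
      convex_function (`[0, +oo[%classic : set (convex_lmodType R^o)) phi ->
      (forall x, 0 <= x -> 0 <= phi x) ->
      0 < phi 0 ->
      (exists a : R, 0 < a < e0 /\ forall x, a <= x -> phi x = 0) ->
      strict_local_max_at_1
        (fun l : {i01 R} => phi_divergence phi (mixture l p p') q)
  ].
Proof.
split; first exact: extreme_no_bounded_density.
split; first exact: no_bounded_density_no_extrapolation.
split; first exact: no_extrapolation_strict_max.
exact: strict_max_extreme.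
Qed.
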